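(* Let $p\ge 1$ and for each $i\in\{0,\ldots,p-1\}$, let $\mathbf{a}_i$ be an infinite sequence over a finite alphabet of non-negative integer digits that is lexicographically greater than $10^\omega$. Then there exists an alternate base $B$ of length $p$ such that $\mathrm{val}_{S^i(B)}(0\bullet\mathbf{a}_i)=1$ for all $i\in\{0,\ldots,p-1\}$.
   Context: An alternate base of length $p\ge 1$ is a bi-infinite sequence $B=(\beta_n)_{n\in\mathbb{Z}}$ of real numbers $\beta_n>1$ with $\beta_{n+p}=\beta_n$ for all $n$ ($p$ need not be the least period); it is written $B=(\beta_{p-1},\ldots,\beta_0)$. For $n\in\mathbb{Z}$, $S^n(B)=(\beta_{m+n})_{m\in\mathbb{Z}}$. For a one-sided infinite sequence $\mathbf{a}=a_1a_2\cdots$ of non-negative integers, $\mathrm{val}_{S^n(B)}(0\bullet\mathbf{a})=\sum_{j=1}^{+\infty}\frac{a_j}{\beta_{n-1}\beta_{n-2}\cdots\beta_{n-j}}$. The sequence $10^\omega$ is $1000\cdots$. *)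

(* Defs.v *)
From HB Require Import structures.
From mathcomp Require Import all_boot all_order all_algebra.
From mathcomp Require Import all_classical all_reals all_analysis.

Set Implicit Arguments.
Unset Strict Implicit.
Unset Printing Implicit Defensive.

Import Order.TTheory GRing.Theory Num.Theory.
Import numFieldNormedType.Exports.

Local Open Scope ring_scope.

(* The finite-list notation (beta_{p-1}, ..., beta_0) is just a name for the
   p-periodic bi-infinite sequence B; p need not be the least period. *)
Definition alternate_base (R : realType) (p : nat) (B : int -> R) : Prop :=
  (forall n : int, 1 < B n) /\ (forall n : int, B (n + p%:Z) = B n).

Definition base_shift (R : realType) (n : int) (B : int -> R) : int -> R :=
  fun m => B (m + n).

(* Infinite words a_1 a_2 ... are functions nat -> nat indexed from 0:
   a j stands for the digit a_{j+1}. *)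

Definition over_finite_alphabet (a : nat -> nat) : Prop :=
  exists d : nat, forall j : nat, (a j <= d)%N.

Definition lex_lt (u v : nat -> nat) : Prop :=
  exists n : nat, (forall k : nat, (k < n)%N -> u k = v k) /\ (u n < v n)%N.

Definition one_zeros : nat -> nat := fun j => if j is 0 then 1%N else 0%N.

(* The value of 0.a_1 a_2 ... in base B,
     sum_{j >= 1} a_j / (B_{-1} B_{-2} ... B_{-j}).
   It is taken in \bar R: for a base with positive terms the series has
   nonnegative terms, so it always has a limit there, and the value is a real
   number exactly when the series converges. *)
Definition val_frac (R : realType) (B : int -> R) (a : nat -> nat) : \bar R :=
  (\sum_(0 <= j <oo)
     ((a j)%:R / \prod_(1 <= k < j.+2) B (- k%:Z))%:E)%E.

(* Main.v *)
(* Look for the base in the form B_n = f(n+1) / (x f(n)) with 0 < x < 1 and f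
   positive and p-periodic: the products of the B_n telescope and the equations
   become the eigenvector problem f = M_x f for the nonnegative operator
     (M_x f)(n) = sum_j a_{n,j} x^j f(n-j).
   This is solved by a Perron-Frobenius argument: among the x admitting a
   nonzero f >= 0 with f <= M_x f there is a least one, by compactness.  There
   f = M_x f, since otherwise f + M_x f, iterated p times, gives a strict
   inequality in every coordinate (the leading digits are at least 1), which
   survives a decrease of x.  The lexicographic hypothesis gives
   f = 1 < M_1 f, hence an admissible x < 1, and it makes B_n > 1. *)
Require Import Defs.
From mathcomp Require Import all_boot all_order all_algebra.
From mathcomp Require Import all_classical all_reals all_analysis.
From mathcomp Require Import ring lra zify.

Set Implicit Arguments.
Unset Strict Implicit.
Unset Printing Implicit Defensive.

Import Order.TTheory GRing.Theory Num.Theory.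
Import numFieldNormedType.Exports.

Local Open Scope ring_scope.
Local Open Scope classical_set_scope.

(** * Periodic functions on the integers *)

Section Periodic.
Variables (R : realType) (p : nat).
Implicit Types f g : int -> R.

Definition nonneg_periodic f : Prop :=
  (forall n, 0 <= f n) /\ (forall n, f (n + p%:Z) = f n).

Lemma periodic_mulz (T : Type) (f : int -> T) :
  (forall n, f (n + p%:Z) = f n) -> forall q n, f (n + q * p%:Z) = f n.
Proof.
move=> fp q n.
have h : forall k m, f (m + k%:Z * p%:Z) = f m.
  elim=> [|k IH] m; first by rewrite mul0r addr0.
  have -> : m + k.+1%:Z * p%:Z = (m + k%:Z * p%:Z) + p%:Z by lia.
  by rewrite fp IH.
case: q => k; first exact: h.
rewrite -[in RHS](subrK (k.+1%:Z * p%:Z) n) h.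
by congr f; lia.
Qed.

Lemma periodic_modz (T : Type) (f : int -> T) :
  (forall n, f (n + p%:Z) = f n) -> forall n, f (n %% p%:Z)%Z = f n.
Proof.
move=> fp n; rewrite [in RHS](divz_eq n p%:Z) addrC.
by rewrite periodic_mulz.
Qed.

Lemma modz_ord (n : int) : (0 < p)%N -> exists i : 'I_p, i%:Z = (n %% p%:Z)%Z.
Proof.
move=> hp; have h0 : 0 <= (n %% p%:Z)%Z by apply: modz_ge0; lia.
have hlt : (`|(n %% p%:Z)%Z| < p)%N.
  by have := ltz_pmod n (_ : 0 < p%:Z); lia.
by exists (Ordinal hlt); rewrite /= gez0_abs.
Qed.

Lemma nonneg_periodicD f g : nonneg_periodic f -> nonneg_periodic g ->
  nonneg_periodic (fun n => f n + g n).
Proof.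
by move=> [f0 fp] [g0 gp]; split => n; rewrite ?addr_ge0 // fp gp.
Qed.

Lemma nonneg_periodic_bounded f : (0 < p)%N -> nonneg_periodic f ->
  exists2 c, 0 <= c & forall n, f n <= c.
Proof.
move=> hp [f0 fp]; exists (\sum_(i < p) f i%:Z); first exact: sumr_ge0.
move=> n; rewrite -periodic_modz //; have [i <-] := modz_ord n hp.
rewrite (bigD1 i) //= lerDl.
exact: sumr_ge0.
Qed.

(** Positivity spreads upward from one point [k], so the window of [p] consecutive points starts at
    an arbitrary [k] rather than at 0. *)
Lemma periodic_forall (P : R -> Prop) f (k : int) : (0 < p)%N ->
  (forall n, f (n + p%:Z) = f n) ->
  (forall t, (t < p)%N -> P (f (k + t%:Z))) -> forall n, P (f n).
Proof.
move=> hp fp hP n.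
have [i iE] := modz_ord (n - k) hp.
have := hP _ (ltn_ord i); rewrite iE.
have gp m : f (k + (m + p%:Z)) = f (k + m) by rewrite addrA fp.
rewrite (periodic_modz (f := fun m => f (k + m)) gp).
by rewrite addrC subrK.
Qed.

End Periodic.

(** * The digit operator: convergence, tail bounds, linearity, strict inequalities *)

Section DigitOperator.
Variables (R : realType) (p : nat) (a : int -> nat -> nat) (D : nat).
Hypothesis p_gt0 : (0 < p)%N.
Hypothesis a_periodic : forall n, a (n + p%:Z) = a n.
Hypothesis a_le : forall n j, (a n j <= D)%N.
Hypothesis a0_ge1 : forall n, (1 <= a n 0)%N.
Hypothesis a_gt : forall n, (2 <= a n 0)%N \/ exists2 j, (0 < j)%N & (1 <= a n j)%N.
Implicit Types (f g w : int -> R) (x y : R).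

Definition digit_term x f (n : int) : R ^nat :=
  fun j => (a n j)%:R * x ^+ j.+1 * f (n - j.+1%:Z).

(** The limit is meaningful only for a convergent series; at [x = 1], where it may diverge, the
    arguments below use partial sums instead. *)
Definition digit_op x f (n : int) : R := limn (series (digit_term x f n)).

Lemma digit_term_ge0 x f n j : 0 <= x -> (forall m, 0 <= f m) ->
  0 <= digit_term x f n j.
Proof. by move=> x0 f0; rewrite /digit_term !mulr_ge0 // exprn_ge0. Qed.

Lemma series_digit_homo x f n : 0 <= x -> (forall m, 0 <= f m) ->
  {homo series (digit_term x f n) : i j / (i <= j)%N >-> i <= j}.
Proof.
move=> x0 f0; apply/nondecreasing_seqP => N.
by rewrite seriesSr lerDl digit_term_ge0.
Qed.

(** Comparison with a geometric series. The error is uniform in [n], in [f] with values in [0, 1]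
    and in [x <= z], as the compactness argument requires. *)
Lemma series_digit_tail x z f n N k : 0 <= x -> x <= z -> z < 1 ->
  (forall m, 0 <= f m <= 1) ->
  series (digit_term x f n) (N + k)%N <=
    series (digit_term x f n) N + D%:R / (1 - z) * z ^+ N * (1 - z ^+ k).
Proof.
move=> x0 xz z1 f01; elim: k => [|k IH].
  by rewrite addn0 expr0 subrr mulr0 addr0.
rewrite addnS seriesSr.
have hd : digit_term x f n (N + k)%N <= D%:R * z ^+ (N + k)%N.
  rewrite /digit_term -[leRHS]mulr1.
  have /andP[fm0 fm1] := f01 (n - (N + k).+1%:Z).
  have z0 : 0 <= z by apply: le_trans xz.
  apply: ler_pM => //; first by rewrite mulr_ge0 // exprn_ge0.
  apply: ler_pM => //; first exact: exprn_ge0.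
    by rewrite ler_nat.
  (* One of the [N + k + 1] factors [x] is bounded by 1, the others by [z]. *)
  rewrite exprS; apply: le_trans (_ : 1 * z ^+ (N + k)%N <= _).
    apply: ler_pM => //; first exact: exprn_ge0.
    - by apply: le_trans xz _; apply: ltW.
    - exact: lerXn2r.
  by rewrite mul1r.
have -> : D%:R / (1 - z) * z ^+ N * (1 - z ^+ k.+1) =
   D%:R / (1 - z) * z ^+ N * (1 - z ^+ k) + D%:R * z ^+ (N + k)%N.
  by rewrite exprD exprS; field; lra.
by rewrite addrA; apply: lerD.
Qed.

Lemma series_digitZ x c f n N :
  series (digit_term x (fun m => c * f m) n) N =
  c * series (digit_term x f n) N.
Proof.
rewrite !seriesEnat /= mulr_sumr; apply: eq_bigr => j _.
by rewrite /digit_term; ring.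
Qed.

Lemma series_digit_cvg x f n : 0 <= x -> x < 1 -> nonneg_periodic p f ->
  cvgn (series (digit_term x f n)).
Proof.
move=> x0 x1 fP; have [f0 fp] := fP.
apply: nondecreasing_is_cvgn; first exact: series_digit_homo.
have [c c0 fc] := nonneg_periodic_bounded p_gt0 fP.
exists ((c + 1) * (D%:R / (1 - x))) => _ [N _ <-].
(* Dividing by [c + 1] brings [f] into [0, 1] even when [c = 0]; the tail bound from index 0 then
   bounds all partial sums. *)
have c1 : 0 < c + 1 by lra.
pose g m := (c + 1)^-1 * f m.
have g01 m : 0 <= g m <= 1.
  rewrite /g mulr_ge0 ?invr_ge0 ?(ltW c1) //= mulrC ler_pdivrMr // mul1r.
  by have := fc m; lra.
have -> : f = fun m => (c + 1) * g m.
  by apply/funext => m; rewrite /g; field; lra.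
rewrite series_digitZ ler_pM2l //.
have := series_digit_tail n 0 N x0 (lexx x) x1 g01.
rewrite add0n [series _ 0]big_geq // add0r expr0 mulr1 => /le_trans; apply.
rewrite -[leRHS]mulr1 ler_wpM2l //.
  by rewrite divr_ge0 //; lra.
by rewrite gerBl exprn_ge0.
Qed.

Lemma digit_op_ge_series x f n N : 0 <= x -> x < 1 -> nonneg_periodic p f ->
  series (digit_term x f n) N <= digit_op x f n.
Proof.
move=> x0 x1 fP; apply: nondecreasing_cvgn_le; last exact: series_digit_cvg.
by apply: series_digit_homo => //; case: fP.
Qed.

Lemma digit_op_le_series x z f n N : 0 <= x -> x <= z -> z < 1 ->
  nonneg_periodic p f -> (forall m, f m <= 1) ->
  digit_op x f n <= series (digit_term x f n) N + D%:R / (1 - z) * z ^+ N.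
Proof.
move=> x0 xz z1 fP f1; have [f0 fp] := fP.
apply: limr_le; first by apply: series_digit_cvg => //; apply: le_lt_trans z1.
exists N => //= k /= Nk.
have f01 m : 0 <= f m <= 1 by rewrite f0 f1.
rewrite -(subnKC Nk); apply: le_trans (series_digit_tail _ _ _ x0 xz z1 f01) _.
have z0 : 0 <= z by apply: le_trans xz.
rewrite lerD2l -[leRHS]mulr1 ler_wpM2l //.
  by rewrite mulr_ge0 ?exprn_ge0 // divr_ge0 //; lra.
by rewrite gerBl exprn_ge0.
Qed.

Lemma digit_op_nonneg_periodic x f : 0 <= x -> x < 1 -> nonneg_periodic p f ->
  nonneg_periodic p (digit_op x f).
Proof.
move=> x0 x1 fP; split => n.
  have := digit_op_ge_series n 0 x0 x1 fP.
  by rewrite [series _ 0]big_geq.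
rewrite /digit_op; congr (limn (series _)); apply/funext => j.
by rewrite /digit_term a_periodic addrAC fP.2.
Qed.

Lemma digit_opD x f g n : 0 <= x -> x < 1 ->
  nonneg_periodic p f -> nonneg_periodic p g ->
  digit_op x (fun m => f m + g m) n = digit_op x f n + digit_op x g n.
Proof.
move=> x0 x1 fP gP; rewrite /digit_op -lim_seriesD; last 2 first.
- exact: series_digit_cvg.
- exact: series_digit_cvg.
congr (limn (series _)); apply/funext => j.
by rewrite /digit_term !fctE mulrDr.
Qed.

Lemma digit_opZ x c f n : 0 <= x -> x < 1 -> nonneg_periodic p f ->
  digit_op x (fun m => c * f m) n = c * digit_op x f n.
Proof.
move=> x0 x1 fP; rewrite /digit_op.
have -> : series (digit_term x (fun m => c * f m) n) =
    (fun N => c * series (digit_term x f n) N).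
  by apply/funext => N; rewrite series_digitZ.
by apply/cvg_lim => //; apply: cvgMr; apply: series_digit_cvg.
Qed.

Lemma digit_op_ge_pred x f n : 0 <= x -> x < 1 -> nonneg_periodic p f ->
  x * f (n - 1) <= digit_op x f n.
Proof.
move=> x0 x1 fP; apply: le_trans (digit_op_ge_series n 1 x0 x1 fP).
rewrite seriesEnat /= big_nat1 /digit_term expr1 ler_wpM2r ?fP.1 //.
by rewrite ler_peMl // ler1n.
Qed.

(** A leading digit at least 2 suffices alone; otherwise a later nonzero digit adds a positive term.
    Finitely many terms are enough, so [x = 1] is allowed. *)
Lemma series_digit_gt_pred x f n : 0 < x -> (forall m, 0 < f m) ->
  exists N, x * f (n - 1) < series (digit_term x f n) N.
Proof.
move=> x0 f0; have xf : 0 < x * f (n - 1) by rewrite mulr_gt0.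
have t0 : x * f (n - 1) <= digit_term x f n 0.
  rewrite /digit_term expr1 ler_wpM2r ?(ltW (f0 _)) //.
  by rewrite ler_peMl ?(ltW x0) // ler1n.
case: (a_gt n) => [a2|[j j0 aj]].
  exists 1%N; rewrite seriesEnat /= big_nat1 /digit_term expr1 ltr_pM2r //.
  by rewrite ltr_pMl // ltr1n.
exists j.+1; rewrite seriesSr.
apply: (@lt_le_trans _ _ (digit_term x f n 0 + digit_term x f n j)); last first.
  rewrite lerD2r -(prednK j0) seriesEnat /= big_nat_recl // lerDl.
  by apply: sumr_ge0 => i _; apply: digit_term_ge0 => [|m]; apply: ltW.
apply: le_lt_trans t0 _; rewrite ltrDl /digit_term.
by rewrite !mulr_gt0 // ?exprn_gt0 // ltr0n.
Qed.

(** The parameter space is general so as to cover both varying [x] with [f] fixed and varying the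
    pair [(x, f)]. *)
Lemma series_digit_continuous (T : topologicalType) (h : T -> R)
    (F : T -> int -> R) n N :
  continuous h -> (forall m, continuous (fun t => F t m)) ->
  continuous (fun t => series (digit_term (h t) (F t) n) N).
Proof.
move=> hc Fc t; elim: N => [|N IH].
  rewrite (_ : (fun _ => _) = cst 0); first exact: cvg_cst.
  by apply/funext => s; rewrite [LHS]big_geq.
rewrite (_ : (fun _ => _) = fun s => series (digit_term (h s) (F s) n) N +
    digit_term (h s) (F s) n N); last first.
  by apply/funext => s; rewrite seriesSr.
apply: cvgD => //; apply: cvgM; last exact: Fc.
apply: cvgM; first exact: cvg_cst.
elim: N.+1 => [|k IHk].
  rewrite expr0 (_ : (fun _ => _) = cst 1); first exact: cvg_cst.
  by apply/funext => s; rewrite expr0.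
rewrite exprS (_ : (fun _ => _) = fun s => h s * h s ^+ k); last first.
  by apply/funext => s; rewrite exprS.
by apply: cvgM => //; exact: hc.
Qed.

(** By periodicity there are only [p] inequalities, each about a partial sum, which is continuous in
    [x]; all of them persist slightly to the left of [x]. *)
Lemma series_digit_left_open x f : 0 < x -> (forall n, f (n + p%:Z) = f n) ->
  (forall n, exists N, f n < series (digit_term x f n) N) ->
  exists2 y, 0 < y < x & forall n, exists N, f n < series (digit_term y f n) N.
Proof.
move=> x0 fp hx.
have /choice[N hN] : forall i : 'I_p,
  exists N, f i%:Z < series (digit_term x f i%:Z) N by move=> i; exact: hx.
have near_x : \forall y \near x^'-,
    0 < y < x /\ forall i : 'I_p, f i%:Z < series (digit_term y f i%:Z) (N i).
  near=> y; split.
    by apply/andP; split; near: y; [exact: nbhs_left_gt|exact: nbhs_left_lt].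
  near: y; apply: filter_forall => i.
  have c : continuous (fun y => series (digit_term y f i%:Z) (N i)).
    by apply: series_digit_continuous => [z|m z]; [exact: cvg_id|exact: cvg_cst].
  by apply: (cvgr_gt _ (cvg_at_left_filter (c x))).
have [y [yx hy]] := filter_ex near_x.
exists y => // n.
have [i iE] := modz_ord n p_gt0.
exists (N i); have := hy i; rewrite iE (periodic_modz fp).
rewrite (periodic_modz (f := fun n => series (digit_term y f n) _)) // => m.
congr (series _ _); apply/funext => j.
by rewrite /digit_term a_periodic addrAC fp.
Unshelve. all: by end_near.
Qed.

(** * Subsolutions, and lowering [x] below a strict one *)

Definition subsolution x f : Prop :=
  [/\ nonneg_periodic p f, exists k, 0 < f k & forall n, f n <= digit_op x f n].

Lemma exists_subsolution : exists2 z, 0 < z < 1 & subsolution z (cst 1).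
Proof.
have c1 : nonneg_periodic p (cst 1 : int -> R) by split.
have [n|z z01 hz] := @series_digit_left_open 1 (cst 1) ltr01 (fun _ => erefl).
  by have := @series_digit_gt_pred 1 (cst 1) n ltr01 (fun _ => ltr01); rewrite mulr1.
have /andP[z0 z1] := z01.
exists z => //; split => //; first by exists 0.
move=> n; have [N hN] := hz n; apply/ltW/(lt_le_trans hN).
by apply: digit_op_ge_series => //; exact: ltW.
Qed.

(* Replacing [f] by [f + digit_op x f] replaces the defect [d] by
   [d + digit_op x d], whose support also contains the shift by 1 of that of
   [d]; after [p] steps the defect is positive everywhere. *)
Lemma subsolution_boost x f k : 0 < x -> x < 1 -> subsolution x f ->
  f k < digit_op x f k ->
  exists2 w, subsolution x w & forall n, w n < digit_op x w n.
Proof.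
move=> x0 x1 [fP [l fl] fle] fk; have x0' := ltW x0.
have H : forall t, exists w d, [/\ nonneg_periodic p w, nonneg_periodic p d,
    0 < w l, forall n, digit_op x w n = w n + d n &
    forall s, (s <= t)%N -> 0 < d (k + s%:Z)].
  elim=> [|t [w [d [wP dP wl wd dpos]]]].
    exists f, (fun n => digit_op x f n - f n); split => //.
    - split=> n; first by rewrite subr_ge0.
      by rewrite (digit_op_nonneg_periodic x0' x1 fP).2 fP.2.
    - by move=> n; rewrite addrC subrK.
    - by move=> s; rewrite leqn0 => /eqP ->; rewrite addr0 subr_gt0.
  have MwP := digit_op_nonneg_periodic x0' x1 wP.
  have MdP := digit_op_nonneg_periodic x0' x1 dP.
  exists (fun n => w n + digit_op x w n), (fun n => d n + digit_op x d n).
  split.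
  - exact: nonneg_periodicD.
  - exact: nonneg_periodicD.
  - by rewrite ltr_pwDl // MwP.1.
  - move=> n; rewrite digit_opD //.
    rewrite (_ : digit_op x w = fun m => w m + d m); last exact/funext.
    by rewrite digit_opD // !wd; ring.
  - move=> s; rewrite leq_eqVlt => /predU1P[->|st]; last first.
      by rewrite ltr_pwDl ?dpos ?MdP.1.
    rewrite ltr_wpDl ?dP.1 //.
    apply: lt_le_trans (digit_op_ge_pred _ x0' x1 dP).
    rewrite mulr_gt0 //.
    have -> : k + t.+1%:Z - 1 = k + t%:Z by lia.
    exact: dpos.
have [w [d [wP dP wl wd dpos]]] := H p.
exists w.
  by split => //; [exists l|move=> n; rewrite wd lerDl dP.1].
move=> n; rewrite wd ltrDl.
apply: (periodic_forall (P := fun r => 0 < r) (k := k) p_gt0 dP.2) => t tp.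
by apply: dpos; exact: ltnW.
Qed.

(** A strict inequality against the limit already holds for some partial sum, and partial sums bound
    [digit_op y f] from below. *)
Lemma subsolution_lower x f : 0 < x -> x < 1 -> subsolution x f ->
  (forall n, f n < digit_op x f n) -> exists2 y, 0 < y < x & subsolution y f.
Proof.
move=> x0 x1 [fP fk _] hlt; have x0' := ltW x0.
have [n|y yx hy] := series_digit_left_open x0 fP.2.
  have h : \forall N \near \oo, f n < series (digit_term x f n) N.
    exact: (cvgr_gt _ (series_digit_cvg (n := n) x0' x1 fP)).
  by have [N hN] := filter_ex h; exists N.
exists y => //; split => // n.
have [N hN] := hy n; have /andP[y0 yx'] := yx.
apply/ltW/(lt_le_trans hN)/digit_op_ge_series => //; first exact: ltW.
exact: lt_trans x1.
Qed.

End DigitOperator.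

(** * The least [x] with a subsolution, by compactness, and the fixed point *)

Section CompactMinimum.
Variables (R : realType) (q : nat) (a : int -> nat -> nat) (D : nat).
Local Notation p := q.+1.
Hypothesis a_periodic : forall n, a (n + p%:Z) = a n.
Hypothesis a_le : forall n j, (a n j <= D)%N.
Hypothesis a0_ge1 : forall n, (1 <= a n 0)%N.
Hypothesis a_gt : forall n, (2 <= a n 0)%N \/ exists2 j, (0 < j)%N & (1 <= a n j)%N.

Definition residue (n : int) : 'I_p := inord `|(n %% p%:Z)%Z|%N.

Lemma residue_ord (i : 'I_p) : residue i%:Z = i.
Proof. by apply: val_inj; rewrite /residue modz_nat /= modn_small // inordK. Qed.

Lemma residueE n : (residue n)%:Z = (n %% p%:Z)%Z.
Proof.
have [i iE] := modz_ord n (ltn0Sn q).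
by rewrite /residue -iE /= inordK.
Qed.

(** Periodic functions are encoded as row vectors over one period, which gives access to compactness
    in finite dimension. *)
Definition periodic_ext (u : 'rV[R]_p) (n : int) : R := u ord0 (residue n).

Lemma periodic_extP (u : 'rV[R]_p) n : periodic_ext u (n + p%:Z) = periodic_ext u n.
Proof. by rewrite /periodic_ext /residue modzDr. Qed.

Lemma periodic_ext_row (f : int -> R) :
  (forall n, f (n + p%:Z) = f n) ->
  periodic_ext (\row_(i < p) f i%:Z) = f.
Proof.
by move=> fp; apply/funext => n; rewrite /periodic_ext mxE residueE periodic_modz.
Qed.

(* The condition [u <= digit_op x u] is expressed through partial sums with an
   error term, which makes it visibly closed in [(x, u)]. *)
Definition subsolution_set (z : R) : set (R * 'rV[R]_p) :=
  (`[0, z] `*` [set u : 'rV[R]_p | forall i, `[0, 1] (u ord0 i)]) `&`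
  ([set t : R * 'rV[R]_p | \sum_i t.2 ord0 i = 1] `&`
   \bigcap_(m in [set: int * nat])
     [set t : R * 'rV[R]_p | 0 <= series (digit_term a t.1 (periodic_ext t.2) m.1) m.2
                 + D%:R / (1 - z) * z ^+ m.2 - periodic_ext t.2 m.1]).

Lemma periodic_ext_continuous n :
  continuous (fun t : R * 'rV[R]_p => periodic_ext t.2 n).
Proof.
move=> t; apply: (@continuous_comp _ _ _ snd (fun u : 'rV[R]_p => u ord0 (residue n))).
  exact: cvg_snd.
exact: coord_continuous.
Qed.

(** A compact box cut by closed conditions. The normalisation to sum 1 is the closed substitute for
    being nonzero. *)
Lemma subsolution_set_compact z : compact (subsolution_set z).
Proof.
apply: compact_closedI.
  apply: compact_setX; first exact: segment_compact.
  apply: (@rV_compact R p (fun=> `[0, 1])) => i.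
  exact: segment_compact.
apply: closedI.
  rewrite (_ : [set t | _] = (fun t : R * 'rV[R]_p => \sum_i t.2 ord0 i) @^-1` [set 1]) //.
  apply: closed_comp; last exact: closed_eq.
  move=> t _; apply: cvg_big => [|i _]; first exact: add_continuous.
  apply: (@continuous_comp _ _ _ snd (fun u : 'rV[R]_p => u ord0 i)).
    exact: cvg_snd.
  exact: coord_continuous.
apply: closed_bigI => -[n N] _ /=.
rewrite (_ : [set t | _] = (fun t : R * 'rV[R]_p =>
  series (digit_term a t.1 (periodic_ext t.2) n) N
                 + D%:R / (1 - z) * z ^+ N - periodic_ext t.2 n) @^-1`
    [set r | 0 <= r]) //.
apply: closed_comp; last exact: closed_ge.
move=> t _; apply: cvgB; last exact: periodic_ext_continuous.
apply: cvgD; last exact: cvg_cst.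
apply: (series_digit_continuous (h := fst)
  (F := fun t : R * 'rV[R]_p => periodic_ext t.2)).
  by move=> s; exact: cvg_fst.
exact: periodic_ext_continuous.
Qed.

Lemma subsolution_setI z x f : z < 1 -> 0 <= x -> x <= z ->
  subsolution p a x f -> exists u, subsolution_set z (x, u).
Proof.
move=> z1 x0 xz [fP [k fk] fle].
have x1 : x < 1 by apply: le_lt_trans z1.
(* Dividing by the sum over one period gives total 1 and, by nonnegativity, entries at most 1. *)
set s := \sum_(i < p) f i%:Z.
have fs n : f n <= s.
  rewrite -(periodic_modz fP.2) -residueE /s (bigD1 (residue n)) //= lerDl.
  by apply: sumr_ge0 => i _; apply: fP.1.
have s0 : 0 < s by apply: lt_le_trans (fs k).
pose g n := s^-1 * f n.
have gP : nonneg_periodic p g.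
  split=> n; last by rewrite /g fP.2.
  by rewrite mulr_ge0 ?invr_ge0 ?(ltW s0) // fP.1.
have g1 n : g n <= 1 by rewrite /g mulrC ler_pdivrMr // mul1r.
exists (\row_(i < p) g i%:Z); split.
  split => /=; first by rewrite in_itv /= x0.
  by move=> i; rewrite /= mxE in_itv /= g1 gP.1.
split => /=.
  under eq_bigr do rewrite mxE.
  by rewrite -mulr_sumr mulVf // gt_eqF.
move=> [n N] _ /=; rewrite (periodic_ext_row gP.2) subr_ge0.
have := digit_op_le_series (ltn0Sn q) a_le n N x0 xz z1 gP g1.
apply: le_trans.
rewrite (digit_opZ (ltn0Sn q) a_le) //.
by rewrite ler_wpM2l ?invr_ge0 ?(ltW s0).
Qed.

Lemma subsolution_setE z x u : z < 1 -> subsolution_set z (x, u) ->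
  [/\ 0 <= x, x <= z & subsolution p a x (periodic_ext u)].
Proof.
move=> z1 [[/= hx hu] [/= sum1 hS]].
move: hx; rewrite in_itv /= => /andP[x0 xz].
have x1 : x < 1 by apply: le_lt_trans z1.
have uP : nonneg_periodic p (periodic_ext u).
  split=> n; last exact: periodic_extP.
  by have := hu (residue n); rewrite /= in_itv /= => /andP[].
split => //; split => //.
  apply: contrapT => hn.
  have : \sum_i u ord0 i = 0.
    apply: big1 => i _; apply/eqP; rewrite eq_le.
    have := hu i; rewrite /= in_itv /= => /andP[-> _]; rewrite andbT leNgt.
    apply/negP => ui; apply: hn; exists i%:Z.
    by rewrite /periodic_ext residue_ord.
  by rewrite sum1 => /eqP; rewrite oner_eq0.
move=> n.
have c := series_digit_cvg (ltn0Sn q) a_le (n := n) x0 x1 uP.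
have z0 : 0 <= z by apply: le_trans xz.
(* As [N] grows the error term vanishes, so the partial-sum conditions yield the inequality for the
   limit. *)
have ct : (fun N => series (digit_term a x (periodic_ext u) n) N
   + D%:R / (1 - z) * z ^+ N) @ \oo --> digit_op a x (periodic_ext u) n.
  rewrite -[X in _ --> X]addr0; apply: cvgD => //.
  rewrite -[X in _ --> X](mulr0 (D%:R / (1 - z))); apply: cvgMr.
  by apply: cvg_expr; rewrite ger0_norm.
rewrite -(cvg_lim _ ct) //; apply: limr_ge; first by apply/cvg_ex; eexists; exact: ct.
by near=> N; have := hS (n, N) I; rewrite /= subr_ge0.
Unshelve. all: by end_near.
Qed.

Lemma exists_min_subsolution : exists (x : R) f, [/\ 0 <= x < 1, subsolution p a x f &
  forall y g, 0 <= y -> subsolution p a y g -> x <= y].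
Proof.
have [z /andP[z0 z1] zS] := exists_subsolution R (ltn0Sn q) a_periodic a_le a0_ge1 a_gt.
have [u zu] := subsolution_setI z1 (ltW z0) (lexx z) zS.
have [] := @compact_EVT_min _ _ (fst : R * 'rV[R]_p -> R) (subsolution_set z).
- by exists (z, u).
- exact: subsolution_set_compact.
- by apply: continuous_subspaceT => t; exact: cvg_fst.
move=> [x v]; rewrite inE => /(subsolution_setE z1)[x0 xz xS] hmin.
exists x, (periodic_ext v); split => //; first by rewrite x0 (le_lt_trans xz).
(* Compactness only covers [y <= z]; for larger [y] the bound follows from [x <= z]. *)
move=> y g y0 yS; have [yz|/ltW zy] := leP y z; last exact: le_trans zy.
have [w wS] := subsolution_setI z1 y0 yz yS.
by have := hmin (y, w); rewrite inE => /(_ wS).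
Qed.

Lemma exists_digit_op_fixpoint : exists (x : R) (f : int -> R),
  [/\ 0 < x < 1, nonneg_periodic p f, forall n, 0 < f n
    & forall n, digit_op a x f n = f n].
Proof.
have [x [f [/andP[x0 x1] fS xmin]]] := exists_min_subsolution.
have [fP [k fk] fle] := fS.
have xgt0 : 0 < x.
  (* At [x = 0] the operator vanishes, contradicting [0 < f k]. *)
  rewrite lt_def x0 andbT; apply/negP => /eqP xE.
  have := fle k; rewrite leNgt => /negP; apply.
  rewrite /digit_op (_ : series _ = cst 0) ?lim_cst //.
  apply/funext => N; apply: big1 => j _.
  by rewrite /digit_term xE expr0n mulr0 mul0r.
have fE n : digit_op a x f n = f n.
  apply/eqP; rewrite eq_le fle andbT leNgt; apply/negP => hn.
  have [w wS wlt] := subsolution_boost (ltn0Sn q) a_periodic a_le a0_ge1 xgt0 x1 fS hn.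
  have [y /andP[y0 yx] yS] := subsolution_lower (ltn0Sn q) a_periodic a_le xgt0 x1 wS wlt.
  by have := xmin y w (ltW y0) yS; rewrite leNgt yx.
exists x, f; split => //; first by rewrite xgt0.
apply: (periodic_forall (P := fun r => 0 < r) (k := k) (ltn0Sn q) fP.2) => t _.
(* Since [f] is fixed, its value at a point is at least [x] times its value at the preceding
   point. *)
elim: t => [|t IH]; first by rewrite addr0.
rewrite -fE.
apply: lt_le_trans (digit_op_ge_pred (ltn0Sn q) a_le a0_ge1 _ x0 x1 fP).
rewrite mulr_gt0 //.
by have -> : k + t.+1%:Z - 1 = k + t%:Z by lia.
Qed.

End CompactMinimum.

Theorem proposition18 (R : realType) (p : nat) (hp : (1 <= p)%N)
    (a : 'I_p -> nat -> nat)
    (ha_fin : forall i : 'I_p, over_finite_alphabet (a i))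
    (ha_lex : forall i : 'I_p, lex_lt one_zeros (a i)) :
  exists B : int -> R, alternate_base p B /\
    forall i : 'I_p, val_frac (base_shift (nat_of_ord i)%:Z B) (a i) = 1%E.
Proof.
case: p hp a ha_fin ha_lex => // q _ a ha_fin ha_lex.
have [d hd] := choice ha_fin.
pose A n := a (residue q n).
have A_per n : A (n + q.+1%:Z) = A n by rewrite /A /residue modzDr.
(* The sum of the individual digit bounds serves all [p] sequences at once. *)
have A_le n j : (A n j <= \sum_i d i)%N.
  apply: leq_trans (hd _ _) _.
  by rewrite (bigD1 (residue q n)) //= leq_addr.
have A0 n : (1 <= A n 0)%N.
  have [[|m] [h1 h2]] := ha_lex (residue q n); first exact: ltnW.
  by rewrite /A -h1.
(* If the first difference with [one_zeros] is at index 0, the leading digit exceeds 1; otherwise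
   the differing digit exceeds 0. *)
have A1 n : (2 <= A n 0)%N \/ exists2 j, (0 < j)%N & (1 <= A n j)%N.
  have [[|m] [h1 h2]] := ha_lex (residue q n); first by left.
  by right; exists m.+1.
have [x [f [/andP[x0 x1] fP f0 fE]]] :=
  exists_digit_op_fixpoint R A_per A_le A0 A1.
exists (fun n => f (n + 1) / (x * f n)); split.
  split=> n; last by rewrite addrAC !fP.2.
  (* The claim is [x * f n < f (n + 1)]: the strict bound at [n + 1], where [f] equals its image. *)
  rewrite ltr_pdivlMr ?mulr_gt0 // mul1r.
  have [N] := series_digit_gt_pred A0 A1 (n + 1) x0 f0.
  rewrite addrK => /lt_le_trans; apply; rewrite -fE.
  exact: digit_op_ge_series (ltW x0) x1 fP.
move=> i.
(* Telescoping; the value uses it with [j.+1] factors, matching the power [x ^+ j.+1] in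
   [digit_term]. *)
have prodE j : \prod_(1 <= k < j.+1)
    (f (- k%:Z + i%:Z + 1) / (x * f (- k%:Z + i%:Z))) =
    f i%:Z / (x ^+ j * f (i%:Z - j%:Z)).
  elim: j => [|j IH].
    by rewrite big_geq // expr0 mul1r subr0 divff // gt_eqF.
  rewrite big_nat_recr //= IH.
  have -> : - j.+1%:Z + i%:Z + 1 = i%:Z - j%:Z by lia.
  have -> : - j.+1%:Z + i%:Z = i%:Z - j.+1%:Z by lia.
  rewrite exprS; field.
  by rewrite expf_neq0 ?gt_eqF.
rewrite /val_frac /base_shift.
(* The partial sums are real and equal those of the operator divided by [f i], so their limit is 1
   by the fixed-point equation. *)
have -> : (fun n => (\sum_(0 <= j < n) ((a i j)%:R /
    \prod_(1 <= k < j.+2) (f (- k%:Z + i%:Z + 1) / (x * f (- k%:Z + i%:Z))))%:E)%E)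
  = EFin \o (fun N => (f i%:Z)^-1 * series (digit_term A x f i%:Z) N).
  apply/funext => N; rewrite sumEFin /=; congr EFin.
  rewrite mulr_sumr; apply: eq_bigr => j _.
  rewrite prodE /digit_term /A residue_ord; field.
  by rewrite expf_neq0 ?gt_eqF.
have c := series_digit_cvg (ltn0Sn q) A_le (n := i%:Z) (ltW x0) x1 fP.
have c' : (fun N => (f i%:Z)^-1 * series (digit_term A x f i%:Z) N) @ \oo --> (1 : R).
  have -> : 1 = (f i%:Z)^-1 * digit_op A x f i%:Z by rewrite fE mulVf ?lt0r_neq0.
  exact: cvgMr.
by rewrite EFin_lim ?(cvg_lim _ c') //; apply/cvg_ex; exists 1.
Qed.
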